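(* Let $p$ be an odd prime, let $m\ge 2$ and $1\le l\le m-1$ be integers with $\gcd(m,l)>1$, and let $q=p^m$. Let $\mathcal{D}$ be the $\mathbb{F}_p$-linear code of length $p^m$ with coordinates indexed by $\mathbb{F}_q$ given by $\mathcal{D}=\{(\mathrm{Tr}(ax^{p^l+1}+bx)+h)_{x\in\mathbb{F}_q} : a,b\in\mathbb{F}_q,\ h\in\mathbb{F}_p\}$ if $l\ne m/2$, and $\mathcal{D}=\{(\mathrm{Tr}(ax^{p^{m/2}+1}+bx)+h)_{x\in\mathbb{F}_q} : a\in\mathbb{F}_{p^{m/2}},\ b\in\mathbb{F}_q,\ h\in\mathbb{F}_p\}$ if $l=m/2$. For each integer $i\ge 1$ such that $\mathcal{D}$ has at least one codeword of Hamming weight $i$, let $\mathcal{B}_i$ be the set of supports $\{x\in\mathbb{F}_q : c_x\neq 0\}$ of all codewords $c\in\mathcal{D}$ of weight $i$. Then $(\mathbb{F}_q,\mathcal{B}_i)$ is a $2$-design.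
   Context: $\mathrm{Tr}$ is the absolute trace from $\mathbb{F}_q$ to $\mathbb{F}_p$. A $2$-$(v,k,\lambda)$ design is a pair $(\mathcal{P},\mathcal{B})$ where $\mathcal{P}$ is a set of $v$ points and $\mathcal{B}$ is a set of $k$-subsets of $\mathcal{P}$ (blocks) such that every $2$-subset of $\mathcal{P}$ is contained in exactly $\lambda$ blocks; a $2$-design is a $2$-$(v,k,\lambda)$ design for some $v,k,\lambda$. *)

(* Defs.v *)
From HB Require Import structures.
From mathcomp Require Import all_boot all_order all_fingroup all_algebra all_field.

Set Implicit Arguments.
Unset Strict Implicit.
Unset Printing Implicit Defensive.

Import GRing.Theory.
Local Open Scope ring_scope.

Section Designs.
Variable T : finType.
Implicit Types (P : {set T}) (B : {set {set T}}).

Definition is_2vkl_design P B (v k lambda : nat) : Prop :=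
  [/\ #|P| = v,
      forall b : {set T}, b \in B -> b \subset P /\ #|b| = k
    & forall s : {set T}, s \subset P -> #|s| = 2 ->
        #|[set b in B | s \subset b]| = lambda].

Definition is_2design P B : Prop :=
  exists v k lambda : nat, is_2vkl_design P B v k lambda.

End Designs.

Section Subfields.
Variable F : finFieldType.

Definition is_subfield (K : {set F}) : bool :=
  (1 \in K) &&
  [forall x in K, forall y in K, (x - y \in K) && (x / y \in K)].

Lemma is_subfieldP (K : {set F}) : reflect (divring_closed K) (is_subfield K).
Proof.
apply: (iffP andP) => [[K1 /forall_inP KP]|[K1 KB KV]]; split=> //.
- by move=> x y xK yK; have /forall_inP/(_ _ yK)/andP[] := KP _ xK.
- by move=> x y xK yK; have /forall_inP/(_ _ yK)/andP[] := KP _ xK.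
by apply/forall_inP => x xK; apply/forall_inP => y yK; rewrite KB // KV.
Qed.

(* A finite field has at most one subfield of each order, so this union has   *)
(* at most one member; it is set0 if F has no subfield of order n.            *)
Definition subfield_of_order (n : nat) : {set F} :=
  \bigcup_(K : {set F} | is_subfield K && (#|K| == n)) K.

End Subfields.

Section Code.
Variables (p : nat) (F : finFieldType) (charFp : p \in [pchar F]).

(* F regarded as a (Galois) extension of its prime field 'F_p.                *)
Local Notation L := (pPrimeCharType charFp).

(* galTrace takes its values in the prime subfield of F; absTr x is the       *)
(* corresponding element of 'F_p, as absTrE shows.                            *)
Definition absTr (x : F) : 'F_p :=
  odflt 0 [pick t : 'F_p | t%:A == galTrace 1 {:L} x :> L].

Lemma absTrE (x : F) : (absTr x)%:A = galTrace 1 {:L} x :> L.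
Proof.
rewrite /absTr; case: pickP => [t /eqP //|no_t].
have /vlineP[t Et] : galTrace 1 {:L} x \in 1%AS.
  by apply: mem_galTrace (memvf _); apply: finField_galois (subvf _).
by have := no_t t; rewrite Et eqxx.
Qed.

(* The condition l = m/2 is the exact equality 2 l = m, not l = m./2, which   *)
(* would also hold for some odd m.                                            *)
Definition coef_set (m l : nat) : {set F} :=
  if l.*2 == m then subfield_of_order F (p ^ m./2) else [set: F].

Definition codeword (l : nat) (a b : F) (h : 'F_p) : {ffun F -> 'F_p} :=
  [ffun x : F => absTr (a * x ^+ (p ^ l + 1) + b * x) + h].

Definition code (m l : nat) : {set {ffun F -> 'F_p}} :=
  [set c | [exists a in coef_set m l, exists b : F, exists h : 'F_p,
     c == codeword l a b h]].

End Code.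

Section Supports.
Variables (F : finType) (R : nmodType).
Implicit Type c : {ffun F -> R}.

Definition supp c : {set F} := [set x | c x != 0].

Definition wt c : nat := #|supp c|.

End Supports.

Definition blocks (F : finType) (R : finNmodType)
    (C : {set {ffun F -> R}}) (i : nat) : {set {set F}} :=
  [set supp c | c in C & wt c == i].

(* Main.v *)
Require Import Defs.
From HB Require Import structures.
From mathcomp Require Import all_boot all_order all_fingroup all_algebra all_field.
From mathcomp Require Import ring.

(** The code is invariant under the substitutions [x := u * x + v], [u != 0]:
    the cross terms of [(u * x + v) ^ (p^l + 1)] are [u^(p^l) * v * x^(p^l)] and
    [u * v^(p^l) * x], and under the trace the former is again of the form
    [Tr (b * x)] because [Tr y = Tr (y^(p^(m-l)))] and [x^(p^m) = x].  When
    [2 l = m], [u^(p^l + 1)] is a norm, so the new coefficient of [x^(p^l + 1)]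
    stays in the subfield.  The affine group being 2-transitive, the supports of
    a given weight form a 2-design. *)

Set Implicit Arguments.
Unset Strict Implicit.
Unset Printing Implicit Defensive.

(** Taking preimages under [s] injects the blocks through [x], [y] into the blocks through [x'],
    [y']. Exchanging the two pairs gives the reverse inequality, so the count is constant. *)
Lemma is_2design_2transitive (T : finType) (B : {set {set T}}) (k : nat) :
  {in B, forall b : {set T}, #|b| = k} ->
  (forall x y x' y' : T, x != y -> x' != y' ->
     exists s : T -> T, [/\ injective s, s x' = x, s y' = y
       & {in B, forall b : {set T}, s @^-1: b \in B}]) ->
  is_2design [set: T] B.
Proof.
move=> Bk Btr; pose N (s : {set T}) := #|[set b in B | s \subset b]|.
have leN x y x' y' : x != y -> x' != y' ->
    (N [set x; y] <= N [set x'; y'])%N.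
  move=> nxy nxy'; have [s [s_inj sx sy sB]] := Btr _ _ _ _ nxy nxy'.
  have s_onto z : s (invF s_inj z) = z by apply: f_invF.
  have pre_inj : injective (fun b : {set T} => s @^-1: b).
    move=> b b' /setP eqb; apply/setP=> z.
    by have := eqb (invF s_inj z); rewrite !inE s_onto.
  rewrite /N -(card_imset _ pre_inj); apply: subset_leq_card.
  apply/subsetP=> _ /imsetP[b /setIdP[bB]] /[swap] ->.
  rewrite subUset !sub1set => /andP[xb yb].
  by rewrite inE sB // subUset !sub1set !inE sx sy xb.
have [t nt | no_t] := pickP (fun t : T * T => t.1 != t.2).
  exists #|T|, k, (N [set t.1; t.2]); split; first by rewrite cardsT.
    by move=> b bB; rewrite subsetT Bk.
  move=> s _ /eqP/cards2P[x [y [nxy ->]]].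
  by apply/eqP; rewrite eqn_leq; apply/andP; split; apply: leN.
(* At most one point: there is no 2-subset, so the value 0 is arbitrary. *)
exists #|T|, k, 0%N; split; first by rewrite cardsT.
  by move=> b bB; rewrite subsetT Bk.
by move=> s _ /eqP/cards2P[x [y [nxy _]]]; have /= := no_t (x, y); rewrite nxy.
Qed.

Section Fields.
Import GRing.Theory.
Local Open Scope ring_scope.

Lemma affine_2transitive (F : fieldType) (x y x' y' : F) :
  x != y -> x' != y' ->
  exists u v, [/\ u != 0, u * x' + v = x & u * y' + v = y].
Proof.
rewrite -!(subr_eq0 x) -(subr_eq0 x') => nxy nxy'.
exists ((x - y) / (x' - y')), (x - (x - y) / (x' - y') * x').
split; first by rewrite mulf_neq0 ?invr_eq0.
  by rewrite addrC subrK.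
rewrite addrCA -mulrBr -(opprB x') mulrN divfK //.
by rewrite opprB addrC subrK.
Qed.

Variable F : finFieldType.

Lemma subfield_mul (K : {set F}) (x y : F) :
  is_subfield K -> x \in K -> y \in K -> x * y \in K.
Proof.
move=> /is_subfieldP[K1 _ KV] xK yK.
by rewrite -[y]invrK KV // -div1r KV.
Qed.

(** Multiplication by [x != 0] permutes the nonzero elements of [K], so their product [P] is
    unchanged by the factor [x ^+ (#|K| - 1)]. *)
Lemma subfield_expf_card (K : {set F}) (x : F) :
  is_subfield K -> x \in K -> x ^+ #|K| = x.
Proof.
move=> Ksub xK; have /is_subfieldP[K1 KB KV] := Ksub.
have K0 : 0 \in K by rewrite -(subrr 1) KB.
have [->|nz_x] := eqVneq x 0.
  by rewrite expr0n; case: #|K| (cardD1 0 K) => [|n]; rewrite ?K0.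
pose P := \prod_(y in K :\ 0) y.
have nz_P : P != 0 by apply/prodf_neq0 => y; rewrite !inE => /andP[].
rewrite (cardsD1 0) K0 exprS.
suff /(mulIf nz_P)-> : x ^+ #|K :\ 0| * P = 1 * P by rewrite mulr1.
rewrite -prodr_const -big_split /= mul1r /P.
rewrite [RHS](reindex_inj (mulfI nz_x)) /=; apply: eq_bigl => y.
rewrite !inE mulf_eq0 (negPf nz_x) /=; congr (_ && _).
apply/idP/idP => [|xyK]; first exact: subfield_mul.
by rewrite -(mulKf nz_x y) mulrC KV.
Qed.

(** The elements of [K] are already [#|K|] roots of ['X^#|K| - 'X]; a fixed point outside [K] would
    be one root too many. *)
Lemma mem_subfield_expf_card (K : {set F}) (x : F) :
  is_subfield K -> (x \in K) = (x ^+ #|K| == x).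
Proof.
move=> Ksub; apply/idP/eqP => [|fix_x]; first exact: subfield_expf_card.
have /is_subfieldP[K1 KB _] := Ksub.
have K_gt1 : (1 < #|K|)%N.
  have K0 : 0 \in K by rewrite -(subrr 1) KB.
  by rewrite (cardsD1 0) (cardsD1 1) K0 !inE K1 oner_neq0.
pose P : {poly F} := 'X^#|K| - 'X.
have szP : size P = #|K|.+1.
  by rewrite size_polyDl size_polyXn // size_polyN size_polyX.
apply: contraT => xK.
have := @max_poly_roots _ P (x :: enum K).
rewrite -size_poly_eq0 szP /= -cardE ltnn => -> //.
  rewrite /root !hornerE fix_x subrr eqxx /=.
  apply/allP=> y; rewrite mem_enum => yK.
  by rewrite /root !hornerE subfield_expf_card // subrr.
by rewrite mem_enum xK enum_uniq.
Qed.

Lemma coef_set_norm (p m l : nat) (a u : F) :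
  #|F| = (p ^ m)%N -> a \in coef_set p F m l ->
  a * u ^+ (p ^ l + 1) \in coef_set p F m l.
Proof.
rewrite /coef_set => cardF; case: eqP => [Em|_]; last by rewrite !inE.
rewrite -Em doubleK => /bigcupP[K /andP[Ksub /eqP cardK] aK].
apply/bigcupP; exists K; first by rewrite Ksub cardK /=.
apply: subfield_mul => //; rewrite mem_subfield_expf_card // cardK.
(* With [2 l = m], raising [u ^+ (p ^ l + 1)] to the power [p ^ l] gives
   [u ^+ (p ^ m) * u ^+ (p ^ l)], and [u ^+ (p ^ m) = u]. *)
rewrite -exprM mulnDl mul1n -expnD addnn Em -cardF exprD expf_card -exprS.
by rewrite addn1.
Qed.

End Fields.

Section Code.
Import GRing.Theory.
Local Open Scope ring_scope.
Variables (p : nat) (F : finFieldType) (charFp : p \in [pchar F]).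
Local Notation L := (pPrimeCharType charFp).
Local Notation Tr := (absTr charFp).

Lemma absTrD (x y : F) : Tr (x + y) = Tr x + Tr y.
Proof.
apply: (fmorph_inj (in_alg L)); rewrite rmorphD /= !absTrE.
exact: (raddfD (galTrace 1 {:L})).
Qed.

(** The Frobenius map lies in the Galois group over the prime field, and the trace is Galois
    invariant; iterate [n] times. *)
Lemma absTr_pexp (x : F) (n : nat) : Tr (x ^+ (p ^ n)) = Tr x.
Proof.
elim: n => [|n <-]; first by rewrite expn0 expr1.
rewrite expnSr exprM; move: (x ^+ _) => {n}x.
apply: (fmorph_inj (in_alg L)); rewrite /= !absTrE.
have [alpha /eqP gen_alpha alphaE] :=
  finField_galois_generator (subvf (1%AS : {subfield L})).
have p_pr := pcharf_prime charFp.
rewrite -(@galTrace_gal _ _ 1%AS {:L}%AS x alpha) ?memvf //.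
  by rewrite alphaE ?memvf // dimv1 expn1 card_Fp.
by rewrite gen_alpha cycle_id.
Qed.

Lemma codeword_affine (m l : nat) (a b u v : F) (h : 'F_p) :
  #|F| = (p ^ m)%N -> (l <= m)%N ->
  exists b' h', forall x,
    codeword charFp l a b h (u * x + v)
      = codeword charFp l (a * u ^+ (p ^ l + 1)) b' h' x.
Proof.
move=> cardF le_lm.
(* The first summand is the coefficient of [x ^+ (p ^ l)] after raising that cross term to the power
   [p ^ (m - l)]; the others are the coefficients of [x]. *)
pose b' := (a * u ^+ (p ^ l) * v) ^+ (p ^ (m - l))
  + a * u * v ^+ (p ^ l) + b * u.
exists b', (Tr (a * v ^+ (p ^ l + 1) + b * v) + h) => x.
rewrite !ffunE addrA -absTrD; congr (_ + h).
have -> : Tr (a * u ^+ (p ^ l + 1) * x ^+ (p ^ l + 1) + b' * x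
              + (a * v ^+ (p ^ l + 1) + b * v))
  = Tr ((a * u ^+ (p ^ l) * v * x ^+ (p ^ l)) ^+ (p ^ (m - l)))
    + Tr (a * u ^+ (p ^ l + 1) * x ^+ (p ^ l + 1)
          + (a * u * v ^+ (p ^ l) + b * u) * x
          + (a * v ^+ (p ^ l + 1) + b * v)).
  rewrite -absTrD exprMn -exprM -expnD subnKC // -cardF expf_card /b'.
  by congr absTr; rewrite !mulrDl -!addrA [RHS]addrCA.
rewrite absTr_pexp -absTrD; congr absTr.
(* The power [p ^ l] is additive in characteristic [p]. *)
have -> : (u * x + v) ^+ (p ^ l + 1)
    = (u ^+ (p ^ l) * x ^+ (p ^ l) + v ^+ (p ^ l)) * (u * x + v).
  rewrite exprD expr1 exprDn_pchar ?exprMn //.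
  rewrite (eq_pnat _ (pcharf_eq charFp)) pnatX.
  by rewrite pnat_id ?(pcharf_prime charFp).
by rewrite !exprD !expr1; move: (p ^ l)%N => n; ring.
Qed.

End Code.

Theorem theorem4 (p m l : nat) (F : finFieldType)
    (p_prime : prime p) (p_odd : odd p)
    (m_ge2 : 2 <= m) (l_ge1 : 1 <= l) (l_le : l <= m - 1)
    (gcd_ml : 1 < gcdn m l) (cardF : #|F| = p ^ m) (i : nat) (i_ge1 : 1 <= i) :
  let D := code (card_finPcharP cardF p_prime) m l in
  (exists2 c, c \in D & wt c = i) ->
  is_2design [set: F] (blocks D i).
Proof.
move=> D _; apply: (@is_2design_2transitive _ _ i).
  by move=> _ /imsetP[c /setIdP[_ /eqP <-] ->].
move=> x y x' y' nxy nxy'.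
have [u [v [nz_u ux uy]]] := affine_2transitive nxy nxy'.
pose s z := (u * z + v)%R; have s_inj : injective s.
  by move=> z t /GRing.addIr /(GRing.mulfI nz_u).
exists s; split=> // _ /imsetP[c /setIdP[Dc /eqP wtc] ->].
pose c' := [ffun z => c (s z)].
have supp_c' : s @^-1: supp c = supp c' by apply/setP=> z; rewrite !inE ffunE.
apply/imsetP; exists c' => //; rewrite inE; apply/andP; split.
  move: Dc; rewrite !inE => /exists_inP[a Da /existsP[b /existsP[h /eqP Dc]]].
  have le_lm : l <= m by rewrite (leq_trans l_le) ?leq_subr.
  have [b' [h' c'E]] :=
    codeword_affine (card_finPcharP cardF p_prime) a b u v h cardF le_lm.
  apply/exists_inP; exists (a * u ^+ (p ^ l + 1))%R; first exact: coef_set_norm.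
  apply/existsP; exists b'; apply/existsP; exists h'; apply/eqP/ffunP=> z.
  by rewrite ffunE Dc c'E.
(* Since [s] is a bijection of the finite field, it maps the preimage of [supp c] onto [supp c], so
   weights agree. *)
rewrite -wtc /wt -supp_c' -(card_imset _ s_inj); apply/eqP/eq_card => z.
by rewrite -[z](f_invF s_inj) mem_imset // !inE.
Qed.
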